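(* Assume the Continuum Hypothesis. Then there is a matroid $M$ on a countable ground set $E$ such that the family $(M,M)$ consisting of two copies of $M$ admits a base packing and a base covering, but does not admit a base partitioning.
   Context: Matroids here are possibly infinite: a matroid is a pair $(E,\mathcal{I})$ with $\mathcal{I}\subseteq\mathcal{P}(E)$ such that (1) $\emptyset\in\mathcal{I}$; (2) $\mathcal{I}$ is closed under subsets; (3) for all $I,B\in\mathcal{I}$ with $B$ maximal in $\mathcal{I}$ and $I$ not maximal, there is $x\in B\setminus I$ with $I\cup\{x\}\in\mathcal{I}$; (4) for every $X\subseteq E$, every $I\in\mathcal{I}$ with $I\subseteq X$ extends to a maximal element of $\mathcal{I}\cap\mathcal{P}(X)$. Bases are maximal independent sets. For a family $(M_i\colon i\in K)$ of matroids on $E$, a family $(B_i\colon i\in K)$ with each $B_i$ a base of $M_i$ is a base covering if $\bigcup_i B_i=E$, a base packing if the $B_i$ are pairwise disjoint, and a base partitioning if it is a partition of $E$. *)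

(* Defs.v *)
Definition subset {E : Type} (X Y : E -> Prop) : Prop := forall x, X x -> Y x.

Section Matroid.
Context {E : Type} (indep : (E -> Prop) -> Prop).

Definition maximal_in (X B : E -> Prop) : Prop :=
  indep B /\ subset B X /\
  forall J, indep J -> subset J X -> subset B J -> subset J B.

Definition is_base (B : E -> Prop) : Prop := maximal_in (fun _ => True) B.

Definition is_matroid : Prop :=
  (* (1) *) indep (fun _ => False) /\
  (* (2) *) (forall X Y, indep Y -> subset X Y -> indep X) /\
  (* (3) *) (forall I B, indep I -> is_base B -> ~ is_base I ->
               exists x, B x /\ ~ I x /\ indep (fun y => I y \/ y = x)) /\
  (* (4) *) (forall X I, indep I -> subset I X ->
               exists J, subset I J /\ maximal_in X J).
End Matroid.

Definition two_base_packing {E : Type} (indep : (E -> Prop) -> Prop) : Prop :=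
  exists B1 B2, is_base indep B1 /\ is_base indep B2 /\
    (forall x, ~ (B1 x /\ B2 x)).

Definition two_base_covering {E : Type} (indep : (E -> Prop) -> Prop) : Prop :=
  exists B1 B2, is_base indep B1 /\ is_base indep B2 /\
    (forall x, B1 x \/ B2 x).

Definition two_base_partitioning {E : Type} (indep : (E -> Prop) -> Prop) : Prop :=
  exists B1 B2, is_base indep B1 /\ is_base indep B2 /\
    (forall x, ~ (B1 x /\ B2 x)) /\ (forall x, B1 x \/ B2 x).

Definition countable_type (T : Type) : Prop :=
  exists f : T -> nat, forall x y, f x = f y -> x = y.

Definition CH : Prop :=
  forall A : (nat -> bool) -> Prop,
    countable_type {x : nat -> bool | A x} \/
    exists g : {x : nat -> bool | A x} -> (nat -> bool),
      (forall x y, g x = g y -> x = y) /\ (forall z, exists x, g x = z).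

(* Main.v *)
(** The matroid is uniform: its bases are closed under exchanging finitely many elements.  Such a
    class of sets is the set of bases of a matroid as soon as it is an antichain and, whenever
    [I] is contained in a base, [I] is a subset of [X] and [X] is not contained in a base, some
    base lies between [I] and [X].  Start with four bases on [nat], two disjoint and two covering,
    none complementary to another.  By CH the pairs [(I, X)] can be handled in an order with
    countable initial segments.  At each step, only countably many classes of bases exist; if
    none of them already decides [(I, X)], then [X \ I] is infinite, and one adds the base
    [I ∪ (X ∩ S)], where [S] splits each of countably many infinite subsets of [X \ I] into two
    infinite parts.  The splitting makes the new base incomparable, modulo finite sets, to the old
    ones and different from their complements, so no base is ever complementary to another. *)

Require Import Defs.
From Stdlib Require Import Arith List Lia Bool Classical ClassicalEpsilon FunctionalExtensionality.
From mathcomp Require boolp wochoice.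

(** * Subsets of the naturals up to finite exchange *)

Definition bset := nat -> bool.

Definition incl (A B : bset) : Prop := forall n, A n = true -> B n = true.

Definition almost_incl (A B : bset) : Prop :=
  exists N, forall n, N <= n -> A n = true -> B n = true.

Definition infinite (A : bset) : Prop := forall N, exists n, N <= n /\ A n = true.

Definition empty : bset := fun _ => false.
Definition full : bset := fun _ => true.
Definition compl (A : bset) : bset := fun n => negb (A n).
Definition inter (A B : bset) : bset := fun n => A n && B n.
Definition union (A B : bset) : bset := fun n => A n || B n.
Definition diff (A B : bset) : bset := fun n => A n && negb (B n).

Fixpoint count (A : bset) (N : nat) : nat :=
  match N with
  | 0 => 0
  | S M => (if A M then 1 else 0) + count A M
  end.

(** [B] arises from [A] by exchanging finitely many elements for equally many others; comparing
    counts below a bound makes this visibly transitive. *)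
Definition exchange (A B : bset) : Prop :=
  exists N, (forall n, N <= n -> A n = B n) /\ count A N = count B N.

Lemma incl_almost A B : incl A B -> almost_incl A B.
Proof. intros H; exists 0; auto. Qed.

Lemma almost_incl_trans A B C : almost_incl A B -> almost_incl B C -> almost_incl A C.
Proof.
  intros [N HN] [M HM]; exists (N + M); intros n Hn Ha.
  apply HM; [lia|]; apply HN; [lia|exact Ha].
Qed.

Lemma not_almost_incl A B : ~ almost_incl A B -> infinite (diff A B).
Proof.
  intros H N; apply NNPP; intros HN; apply H; exists N; intros n Hn Ha.
  destruct (B n) eqn:Hb; [reflexivity|].
  exfalso; apply HN; exists n; split; [exact Hn|]; unfold diff; now rewrite Ha, Hb.
Qed.

Lemma infinite_not_almost_incl A B : infinite (diff A B) -> ~ almost_incl A B.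
Proof.
  intros H [N HN]; destruct (H N) as [n [Hn Hd]].
  apply andb_true_iff in Hd as [Ha Hb]; rewrite (HN n Hn Ha) in Hb; discriminate.
Qed.

Lemma infinite_mono A B : incl A B -> infinite A -> infinite B.
Proof. intros H HA N; destruct (HA N) as [n [Hn Ha]]; exists n; auto. Qed.

Lemma count_eq_above A B N M :
  N <= M -> (forall n, N <= n -> A n = B n) -> count A N = count B N -> count A M = count B M.
Proof.
  intros HNM H HN; induction HNM as [|M HNM IH]; [exact HN|].
  simpl; now rewrite (H M HNM), IH.
Qed.

Lemma count_ext A B N : (forall n, n < N -> A n = B n) -> count A N = count B N.
Proof.
  induction N as [|N IH]; intros H; [reflexivity|].
  simpl; rewrite (H N), IH; auto.
Qed.

Lemma count_le A B N : (forall n, n < N -> A n = true -> B n = true) -> count A N <= count B N.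
Proof.
  induction N as [|N IH]; intros H; [reflexivity|].
  simpl; assert (count A N <= count B N) by (apply IH; auto).
  destruct (A N) eqn:Ha; [rewrite (H N); auto; lia|destruct (B N); lia].
Qed.

Lemma count_incl_eq A B N :
  (forall n, n < N -> A n = true -> B n = true) -> count A N = count B N ->
  forall n, n < N -> A n = B n.
Proof.
  induction N as [|N IH]; intros H Hc n Hn; [lia|].
  assert (Hle : count A N <= count B N) by (apply count_le; auto).
  simpl in Hc.
  assert (HN : A N = B N).
  { destruct (A N) eqn:Ha; [now rewrite (H N); auto|].
    destruct (B N); [lia|reflexivity]. }
  destruct (Nat.eq_dec n N) as [->|Hne]; [exact HN|].
  apply IH; [auto| |lia]. rewrite HN in Hc; lia.
Qed.

Lemma exchange_refl A : exchange A A.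
Proof. exists 0; auto. Qed.

Lemma exchange_sym A B : exchange A B -> exchange B A.
Proof. intros [N [H Hc]]; exists N; split; [intros n Hn; symmetry; auto|auto]. Qed.

Lemma exchange_trans A B C : exchange A B -> exchange B C -> exchange A C.
Proof.
  intros [N [H Hc]] [M [H' Hc']]; exists (N + M); split.
  - intros n Hn; rewrite H, H'; auto; lia.
  - rewrite (count_eq_above A B N), (count_eq_above B C M); auto; lia.
Qed.

Lemma exchange_almost_incl A B : exchange A B -> almost_incl A B.
Proof. intros [N [H _]]; exists N; intros n Hn Ha; now rewrite <- H. Qed.

(** Below [N] the counts of a set and of its complement add up to [N]. *)
Lemma exchange_compl A B : exchange A B -> exchange (compl A) (compl B).
Proof.
  intros [N [H Hc]]; exists N; split; [intros n Hn; unfold compl; now rewrite H|].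
  assert (Hn : forall C, count C N + count (compl C) N = N).
  { intros C; clear; induction N as [|N IH]; [reflexivity|].
    simpl; unfold compl at 1; destruct (C N); simpl; lia. }
  generalize (Hn A) (Hn B); lia.
Qed.

(** Beyond the bound the sets agree; below it, inclusion with equal counts leaves no room. So each
    exchange class is an antichain. *)
Lemma exchange_incl_eq A B : exchange A B -> incl A B -> A = B.
Proof.
  intros [N [H Hc]] Hi; apply functional_extensionality; intros n.
  destruct (le_lt_dec N n) as [Hn|Hn]; [auto|].
  apply (count_incl_eq A B N); auto.
Qed.

Definition upd (A : bset) (x : nat) (b : bool) : bset := fun n => if Nat.eqb n x then b else A n.

Lemma count_upd A x N :
  x < N -> A x = false -> count (upd A x true) N = S (count A N).
Proof.
  induction N as [|N IH]; intros Hx HA; [lia|].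
  simpl; unfold upd at 1; destruct (Nat.eqb_spec N x) as [->|Hne].
  - rewrite HA; simpl; f_equal; apply count_ext; intros n Hn; unfold upd.
    destruct (Nat.eqb_spec n x); [lia|reflexivity].
  - rewrite IH; auto; lia.
Qed.

Lemma exchange_swap A x y :
  A x = false -> A y = true -> exchange (upd (upd A y false) x true) A.
Proof.
  intros Hx Hy; exists (S (x + y)); split.
  - intros n Hn; unfold upd.
    destruct (Nat.eqb_spec n x); [lia|]; destruct (Nat.eqb_spec n y); [lia|reflexivity].
  - assert (x <> y) by congruence.
    (* Both counts are one more than the count of [A] without [y]. *)
    rewrite count_upd; [|lia|unfold upd; destruct (Nat.eqb_spec x y); [lia|exact Hx]].
    rewrite <- (count_upd (upd A y false) y);
      [|lia|unfold upd; now rewrite Nat.eqb_refl].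
    apply count_ext; intros n _; unfold upd.
    destruct (Nat.eqb_spec n y) as [->|]; auto.
Qed.

(** * Interpolation by finite exchange *)

Lemma count_interpolate I X N k :
  (forall n, n < N -> I n = true -> X n = true) -> count I N <= k <= count X N ->
  exists C : bset, (forall n, n < N -> I n = true -> C n = true) /\
            (forall n, n < N -> C n = true -> X n = true) /\ count C N = k.
Proof.
  revert k; induction N as [|N IH]; intros k H Hk.
  { exists empty; simpl in *; repeat split; intros; lia. }
  assert (Hsub : forall n, n < N -> I n = true -> X n = true) by auto.
  assert (HN := H N (Nat.lt_succ_diag_r N)).
  simpl in Hk.
  (* Whether [N] enters [C] is chosen so that the remaining target [j] stays between the two counts
     below [N]. *)
  assert (Hb : exists (b : bool) j, (I N = true -> b = true) /\ (b = true -> X N = true) /\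
             count I N <= j <= count X N /\ (if b then 1 else 0) + j = k).
  { generalize (count_le I X N Hsub); intros Hle.
    destruct (I N) eqn:Hi.
    - rewrite HN in Hk; auto. exists true, (k - 1); repeat split; auto; simpl; lia.
    - destruct (X N) eqn:Hx.
      + destruct (le_lt_dec k (count X N)).
        * exists false, k; repeat split; auto; simpl; lia.
        * exists true, (k - 1); repeat split; auto; simpl; lia.
      + exists false, k; repeat split; auto; try discriminate; simpl; lia. }
  destruct Hb as [b [j [Hb1 [Hb2 [Hj Hbj]]]]].
  destruct (IH j Hsub Hj) as [C [HC1 [HC2 HC3]]].
  assert (Heq : forall n, n < S N -> n = N \/ n < N) by lia.
  exists (upd C N b); split; [|split].
  - intros n Hn Hi; unfold upd; destruct (Nat.eqb_spec n N) as [->|]; auto.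
    apply HC1; auto; lia.
  - intros n Hn; unfold upd; destruct (Nat.eqb_spec n N) as [->|]; auto.
    apply HC2; lia.
  - simpl; unfold upd at 1; rewrite Nat.eqb_refl.
    rewrite (count_ext (upd C N b) C), HC3; auto.
    intros n Hn; unfold upd; destruct (Nat.eqb_spec n N); [lia|reflexivity].
Qed.

(** Past [N] every disagreement is a point of [B] outside [I], which shrinks the positive gap
    [count I M - count B M]; so there are only finitely many. *)
Lemma count_lt_agree I B N :
  (forall n, N <= n -> I n = true -> B n = true) ->
  (forall M, N <= M -> count B M < count I M) ->
  exists M, N <= M /\ forall n, M <= n -> I n = B n.
Proof.
  intros H Hc.
  assert (Hind : forall d M, N <= M -> count I M - count B M = d ->
            exists M, N <= M /\ forall n, M <= n -> I n = B n).
  { induction d as [d IH] using lt_wf_ind; intros M HM Hd.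
    destruct (classic (forall n, M <= n -> I n = B n)) as [Ha|Ha]; [eauto|].
    apply not_all_ex_not in Ha as [n Hn]; apply imply_to_and in Hn as [Hn HI].
    assert (Hmono : count I n - count B n <= count I M - count B M).
    { clear - HM Hn H Hc. induction Hn as [|n Hn IH]; [lia|].
      simpl; assert (N <= n) by lia.
      generalize (Hc n H0); generalize (H n H0).
      destruct (I n), (B n); intros; try lia. }
    assert (N <= n) by lia.
    assert (HSn : count I (S n) - count B (S n) < count I n - count B n).
    { generalize (Hc n H0) (H n H0); simpl.
      destruct (I n), (B n); intros; try congruence; try lia. }
    apply (IH (count I (S n) - count B (S n))) with (M := S n); lia. }
  apply (Hind _ N (le_n N) eq_refl).
Qed.

Lemma exchange_glue B C M :
  count C M = count B M -> exchange (fun n => if n <? M then C n else B n) B.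
Proof.
  intros H; exists M; split.
  - intros n Hn; destruct (Nat.ltb_spec n M); [lia|reflexivity].
  - rewrite <- H; apply count_ext; intros n Hn.
    destruct (Nat.ltb_spec n M); [reflexivity|lia].
Qed.

(** Only the size of the finite part matters: if [B] always has too few elements for [I], it
    exchanges into a subset of [I]; if always too many for [X], into a superset of [X]; otherwise it
    fits in between. *)
Lemma exchange_interpolate I B X :
  incl I X -> almost_incl I B -> almost_incl B X ->
  exists C, exchange C B /\ (incl X C \/ incl C I \/ incl I C /\ incl C X).
Proof.
  intros HIX [N0 H0] [N1 H1].
  pose (N := N0 + N1).
  assert (HIB : forall n, N <= n -> I n = true -> B n = true) by (intros; apply H0; auto; lia).
  assert (HBX : forall n, N <= n -> B n = true -> X n = true) by (intros; apply H1; auto; lia).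
  clearbody N; clear H0 H1 N0 N1.
  destruct (classic (forall M, N <= M -> count B M < count I M)) as [Hlt|Hlt].
  { destruct (count_lt_agree I B N HIB Hlt) as [M [HM Hag]].
    destruct (count_interpolate empty I M (count B M)) as [C [_ [HC Hc]]].
    - discriminate.
    - split; [|specialize (Hlt M HM); lia].
      apply count_le; discriminate.
    - exists (fun n => if n <? M then C n else B n); split; [now apply exchange_glue|].
      right; left; intros n; destruct (Nat.ltb_spec n M); [auto|rewrite Hag; auto]. }
  destruct (classic (forall M, N <= M -> count X M < count B M)) as [Hgt|Hgt].
  { destruct (count_lt_agree B X N HBX Hgt) as [M [HM Hag]].
    destruct (count_interpolate X full M (count B M)) as [C [HC [_ Hc]]].
    - reflexivity.
    - split; [specialize (Hgt M HM); lia|]. apply count_le; reflexivity.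
    - exists (fun n => if n <? M then C n else B n); split; [now apply exchange_glue|].
      left; intros n; destruct (Nat.ltb_spec n M); [auto|rewrite Hag; auto]. }
  apply not_all_ex_not in Hlt as [M1 Hlt]; apply imply_to_and in Hlt as [HM1 Hlt].
  apply not_all_ex_not in Hgt as [M2 Hgt]; apply imply_to_and in Hgt as [HM2 Hgt].
  (* Past [N] an inequality between these counts persists once true, so [M1] and [M2] can be
     replaced by a common bound. *)
  assert (Hmono : forall A C, (forall n, N <= n -> A n = true -> C n = true) ->
     forall M M', N <= M -> M <= M' -> count A M <= count C M -> count A M' <= count C M').
  { intros A C HAC M M' HM HMM Hc; induction HMM as [|M' HMM IH]; [exact Hc|].
    simpl; assert (HM' : N <= M') by lia; specialize (HAC M' HM').
    destruct (A M'); [rewrite HAC by reflexivity|destruct (C M')]; lia. }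
  pose (M := M1 + M2).
  destruct (count_interpolate I X M (count B M)) as [C [HC1 [HC2 Hc]]].
  - auto.
  - split; [apply (Hmono I B HIB M1)|apply (Hmono B X HBX M2)]; unfold M; lia.
  - exists (fun n => if n <? M then C n else B n); split; [now apply exchange_glue|].
    right; right; split; intros n; destruct (Nat.ltb_spec n M); auto;
      [apply HIB|apply HBX]; unfold M in *; lia.
Qed.

(** * Splitting countably many infinite sets *)

(** Cut [nat] into consecutive blocks so that block [m] meets every infinite [f k] with [k <= m];
    the union of the even blocks splits all of them. *)
Lemma split_countably_many (f : nat -> bset) :
  exists S, forall k, infinite (f k) -> infinite (inter (f k) S) /\ infinite (diff (f k) S).
Proof.
  assert (Hnext : forall n, exists m, n < m /\
     forall k, k <= n -> infinite (f k) -> exists x, n <= x < m /\ f k x = true).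
  { intros n.
    assert (Hj : forall j, exists m, n < m /\
       forall k, k < j -> infinite (f k) -> exists x, n <= x < m /\ f k x = true).
    { induction j as [|j [m [Hm IH]]]; [exists (S n); split; intros; lia|].
      destruct (classic (infinite (f j))) as [Hi|Hi].
      - destruct (Hi n) as [x [Hx Hfx]].
        exists (m + S x); split; [lia|]; intros k Hk Hki.
        destruct (Nat.eq_dec k j) as [->|Hne]; [exists x; split; [lia|exact Hfx]|].
        destruct (IH k) as [y [Hy Hfy]]; [lia|exact Hki|].
        exists y; split; [lia|exact Hfy].
      - exists m; split; [exact Hm|]; intros k Hk Hki.
        destruct (Nat.eq_dec k j) as [->|Hne]; [contradiction|].
        apply IH; [lia|exact Hki]. }
    destruct (Hj (S n)) as [m [Hm H]]; exists m; split; [exact Hm|].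
    intros k Hk; apply H; lia. }
  pose (next n := proj1_sig (constructive_indefinite_description _ (Hnext n))).
  assert (Hn : forall n, n < next n /\
     forall k, k <= n -> infinite (f k) -> exists x, n <= x < next n /\ f k x = true).
  { intros n; exact (proj2_sig (constructive_indefinite_description _ (Hnext n))). }
  clearbody next; clear Hnext.
  pose (h := fix h n := match n with 0 => 0 | S n => next (h n) end).
  assert (hS : forall n, h n < h (S n)) by (intros n; apply Hn).
  assert (hmono : forall n m, n <= m -> h n <= h m).
  { intros n m H; induction H as [|m H IH]; [lia|]. specialize (hS m); lia. }
  assert (hge : forall n, n <= h n).
  { induction n as [|n IH]; [lia|]. specialize (hS n); lia. }
  assert (hhit : forall k m, k <= m -> infinite (f k) ->
            exists x, h m <= x < h (S m) /\ f k x = true).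
  { intros k m Hk Hi; apply (Hn (h m)); [specialize (hge m); lia|exact Hi]. }
  pose (P x := exists m, h (2 * m) <= x < h (S (2 * m))).
  exists (fun x => if excluded_middle_informative (P x) then true else false).
  intros k Hi; split; intros N.
  - destruct (hhit k (2 * (k + N))) as [x [Hx Hfx]]; [lia|exact Hi|].
    exists x; split; [specialize (hge (2 * (k + N))); lia|].
    unfold inter; rewrite Hfx; destruct (excluded_middle_informative (P x)) as [H|H];
      [reflexivity|]; exfalso; apply H; now exists (k + N).
  - destruct (hhit k (S (2 * (k + N)))) as [x [Hx Hfx]]; [lia|exact Hi|].
    exists x; split; [specialize (hge (S (2 * (k + N)))); lia|].
    unfold diff; rewrite Hfx; destruct (excluded_middle_informative (P x)) as [[m Hm]|H];
      [|reflexivity]; exfalso.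
    destruct (le_lt_dec m (k + N)) as [Hle|Hlt].
    + specialize (hmono (S (2 * m)) (S (2 * (k + N)))); lia.
    + specialize (hmono (S (S (2 * (k + N)))) (2 * m)); lia.
Qed.

(** * Compatible families and settled pairs *)

(** The first conjunct keeps distinct exchange classes incomparable modulo finite sets, the second
    rules out a partition into two bases. Both are invariant under exchange, so representatives
    suffice. *)
Definition compatible (A B : bset) : Prop :=
  (exchange A B \/ ~ almost_incl A B /\ ~ almost_incl B A) /\ ~ exchange A (compl B).

Lemma compl_involutive A : compl (compl A) = A.
Proof. apply functional_extensionality; intros n; apply negb_involutive. Qed.

Lemma compatible_refl A : compatible A A.
Proof.
  split; [left; apply exchange_refl|].
  intros [N [H _]]; specialize (H N (le_n N)); unfold compl in H; destruct (A N); discriminate.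
Qed.

Lemma compatible_sym A B : compatible A B -> compatible B A.
Proof.
  intros [H Hc]; split.
  - destruct H as [H|H]; [left; now apply exchange_sym|tauto].
  - intros HB; apply Hc; apply exchange_compl in HB; rewrite compl_involutive in HB.
    now apply exchange_sym.
Qed.

Lemma compatible_exchange_r A B C : compatible A B -> exchange C B -> compatible A C.
Proof.
  intros [H Hc] HC; split.
  - destruct H as [H|[H1 H2]]; [left; eapply exchange_trans; eauto using exchange_sym|].
    right; split; intros Hi; [apply H1|apply H2]; eapply almost_incl_trans; eauto;
      apply exchange_almost_incl; auto using exchange_sym.
  - intros HA; apply Hc; eapply exchange_trans; eauto; now apply exchange_compl.
Qed.

Lemma compatible_incl_eq A B : compatible A B -> incl A B -> A = B.
Proof.
  intros [[H|[H _]] _] Hi; [now apply exchange_incl_eq|].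
  now apply incl_almost in Hi.
Qed.

Definition good (F : bset -> Prop) : Prop := forall A B, F A -> F B -> compatible A B.

(** These sets will be the bases of the matroid. *)
Definition closure (F : bset -> Prop) (C : bset) : Prop := exists B, F B /\ exchange C B.

Definition add (F : bset -> Prop) (B A : bset) : Prop := F A \/ A = B.

Lemma good_closure F : good F -> good (closure F).
Proof.
  intros H A B [A' [HA HAA]] [B' [HB HBB]].
  apply (compatible_exchange_r _ B'); [|exact HBB].
  apply compatible_sym, (compatible_exchange_r _ A'); [|exact HAA].
  now apply H.
Qed.

(** Whichever alternative holds, a uniform matroid with bases [closure F] satisfies axiom (4)
    for [X] and the independent set [I]. *)
Definition settles (F : bset -> Prop) (I X : bset) : Prop :=
  almost_incl X I \/
  exists C, closure F C /\ (incl X C \/ incl C I \/ incl I C /\ incl C X).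

Lemma settles_mono (F G : bset -> Prop) I X :
  (forall A, F A -> G A) -> settles F I X -> settles G I X.
Proof.
  intros H [Hf|[C [[B [HB HC]] HI]]]; [now left|].
  right; exists C; split; [exists B; auto|exact HI].
Qed.

Lemma settles_between (F : bset -> Prop) I X B :
  F B -> incl I X -> almost_incl I B -> almost_incl B X -> settles F I X.
Proof.
  intros HB HIX HI HX; destruct (exchange_interpolate I B X HIX HI HX) as [C [HC HH]].
  right; exists C; split; [exists B; auto|exact HH].
Qed.

(** Interpolate [B] between [empty] and [I]. Either the result lies in [I], or it contains [I], and
    then [B] is almost between [I] and [X]. *)
Lemma settles_below (F : bset -> Prop) I X B :
  F B -> incl I X -> almost_incl B I -> settles F I X.
Proof.
  intros HB HIX HI.
  assert (HBX : almost_incl B X) by (apply (almost_incl_trans _ I); auto using incl_almost).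
  destruct (exchange_interpolate empty B I) as [C [HC HH]].
  - discriminate.
  - exists 0; discriminate.
  - exact HI.
  - destruct HH as [HH|HH].
    + apply (settles_between F I X B); auto.
      apply (almost_incl_trans _ C); [now apply incl_almost|now apply exchange_almost_incl].
    + right; exists C; split; [exists B; auto|].
      right; left; destruct HH as [HH|HH]; [|apply HH].
      intros n Hn; discriminate (HH n Hn).
Qed.

(** Dual to [settles_below], interpolating between [X] and [full]. *)
Lemma settles_above (F : bset -> Prop) I X B :
  F B -> incl I X -> almost_incl X B -> settles F I X.
Proof.
  intros HB HIX HX.
  assert (HIB : almost_incl I B) by (apply (almost_incl_trans _ X); auto using incl_almost).
  destruct (exchange_interpolate X B full) as [C [HC HH]].
  - intros n _; reflexivity.
  - exact HX.
  - exists 0; reflexivity.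
  - destruct HH as [HH|[HH|HH]].
    + right; exists C; split; [exists B; auto|].
      left; intros n _; now apply HH.
    + apply (settles_between F I X B); auto.
      apply (almost_incl_trans _ C); [|now apply incl_almost].
      now apply exchange_almost_incl, exchange_sym.
    + right; exists C; split; [exists B; auto|]. left; apply HH.
Qed.

(** * Adding one base *)

Lemma extend_good (F : bset -> Prop) (f : nat -> bset) I X :
  (forall A, F A -> exists n, f n = A) -> (exists A, F A) -> good F -> incl I X ->
  exists B, good (add F B) /\ settles (add F B) I X.
Proof.
  intros Hf [A0 HA0] HF HIX.
  destruct (classic (settles F I X)) as [Hs|Hs].
  (* A settled pair needs nothing new, so an old member is repeated. *)
  { exists A0; split.
    - intros A B [HA|HA] [HB|HB]; subst; auto.
    - revert Hs; apply settles_mono; now left. }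
  assert (HXI : ~ almost_incl X I) by (intros H; apply Hs; now left).
  (* Even indices list the traces of the members of [F] on [diff X I], odd indices the remainders,
     so one [S] splits both kinds. *)
  destruct (split_countably_many
    (fun n => if Nat.even n then inter (diff X I) (f (Nat.div2 n))
              else diff (diff X I) (f (Nat.div2 n)))) as [S HS].
  assert (HS1 : forall A, F A -> infinite (inter (diff X I) A) ->
     infinite (inter (inter (diff X I) A) S) /\ infinite (diff (inter (diff X I) A) S)).
  { intros A HA; destruct (Hf A HA) as [n <-]; specialize (HS (2 * n)).
    cbv beta in HS; rewrite Nat.even_even, Nat.div2_double in HS; exact HS. }
  assert (HS2 : forall A, F A -> infinite (diff (diff X I) A) ->
     infinite (inter (diff (diff X I) A) S) /\ infinite (diff (diff (diff X I) A) S)).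
  { intros A HA; destruct (Hf A HA) as [n <-]; specialize (HS (2 * n + 1)).
    cbv beta in HS; rewrite Nat.even_odd, Nat.add_1_r, Nat.div2_succ_double in HS; exact HS. }
  pose (B := union I (inter X S)).
  assert (HIB : incl I B) by (intros n Hn; unfold B, union; now rewrite Hn).
  assert (HBX : incl B X).
  { intros n; unfold B, union, inter; specialize (HIX n).
    destruct (I n), (X n); simpl; auto. }
  assert (Hcompat : forall A, F A -> compatible B A).
  { intros A HA.
    (* An old base almost below [I], almost above [X] or almost between them would already settle
       the pair. *)
    assert (H1 : ~ almost_incl A I) by (intros H; apply Hs; now apply (settles_below F I X A)).
    assert (H2 : ~ almost_incl X A) by (intros H; apply Hs; now apply (settles_above F I X A)).
    assert (H3 : ~ (almost_incl I A /\ almost_incl A X)).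
    { intros [H H']; apply Hs; now apply (settles_between F I X A). }
    split; [right; split|].
    (* If [I] is almost in [A], then [diff (diff X I) A] is infinite, as [X] is not almost in [A];
       [S] puts infinitely many of its points into [B]. *)
    - destruct (classic (almost_incl I A)) as [HIA|HIA].
      + apply infinite_not_almost_incl.
        apply (infinite_mono (inter (diff (diff X I) A) S)).
        * intros n; unfold B, diff, inter, union; destruct (X n), (I n), (A n), (S n); auto.
        * apply HS2; [exact HA|]. apply not_almost_incl; intros [N HN]; apply H2.
          destruct HIA as [M HM]; exists (N + M); intros n Hn Hx.
          destruct (I n) eqn:Hi; [apply HM; auto; lia|].
          apply HN; [lia|]; unfold diff; now rewrite Hx, Hi.
      + intros H; apply HIA; apply (almost_incl_trans _ B); auto using incl_almost.
    (* If [A] is almost in [X], it has infinitely many points in [diff X I]; [S] keeps infinitely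
       many of them out of [B]. *)
    - destruct (classic (almost_incl A X)) as [HAX|HAX].
      + apply infinite_not_almost_incl.
        apply (infinite_mono (diff (inter (diff X I) A) S)).
        * intros n; unfold B, diff, inter, union; destruct (X n), (I n), (A n), (S n); auto.
        * apply HS1; [exact HA|]. apply (infinite_mono (diff (inter A X) I)).
          { intros n; unfold diff, inter; destruct (X n), (I n), (A n); auto. }
          apply not_almost_incl; intros [N HN]; apply H1.
          destruct HAX as [M HM]; exists (N + M); intros n Hn Ha.
          apply HN; [lia|]; unfold inter; rewrite Ha, HM; auto; lia.
      + intros H; apply HAX; apply (almost_incl_trans _ B); auto using incl_almost.
    (* As [diff X I] is infinite, so is its part inside or outside [A]. Splitting gives points in
       both [A] and [B] in the first case, in neither in the second; either refutes
       complementarity. *)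
    - intros [N [HN _]].
      destruct (classic (infinite (inter (diff X I) A))) as [Hi|Hi].
      + apply HS1 in Hi as [Hi _]; [|exact HA]. destruct (Hi N) as [n [Hn H]].
        specialize (HN n Hn); revert H HN; unfold B, diff, inter, union, compl.
        destruct (X n), (I n), (A n), (S n); simpl; congruence.
      + assert (Hd : infinite (diff (diff X I) A)).
        { apply not_almost_incl; intros [M HM]; apply Hi; intros K.
          destruct (not_almost_incl X I HXI (M + K)) as [n [Hn Hx]].
          exists n; split; [lia|]; unfold inter; rewrite Hx, HM; auto; lia. }
        apply HS2 in Hd as [_ Hd]; [|exact HA]. destruct (Hd N) as [n [Hn H]].
        specialize (HN n Hn); revert H HN; unfold B, diff, inter, union, compl.
        destruct (X n), (I n), (A n), (S n); simpl; congruence. }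
  exists B; split.
  - intros A A' [HA|HA] [HA'|HA']; subst; auto using compatible_refl, compatible_sym.
  - right; exists B; split; [|auto]. exists B; split; [now right|apply exchange_refl].
Qed.

(** * Transfinite construction under CH *)

(** A well-order with an uncountable initial segment is cut down: the least such segment has only
    countable proper segments, and its order is carried over to all of [bset]. *)
Lemma CH_well_order :
  CH -> exists R : bset -> bset -> Prop,
    well_founded R /\ (forall a b, R a b \/ a = b \/ R b a) /\
    forall a, countable_type {b | R b a}.
Proof.
  intros HCH.
  assert (Hwo : exists R : bset -> bset -> Prop,
            (forall P : bset -> Prop, (exists a, P a) ->
               exists a, P a /\ forall b, P b -> ~ R b a) /\
            (forall a b, R a b \/ a = b \/ R b a)).
  { destruct (wochoice.well_ordering_principle (boolp.boolp_classicType__canonical__eqtype_Equality bset)) as [W HW].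
    assert (Hmin : forall P : bset -> Prop, (exists a, P a) ->
              exists a, (P a /\ forall b, P b -> W a b = true) /\
                forall a', P a' -> (forall b, P b -> W a' b = true) -> a = a').
    { intros P [a Ha].
      pose (p x := if excluded_middle_informative (P x) then true else false).
      assert (Hp : forall x, p x = true <-> P x).
      { intros x; unfold p; destruct (excluded_middle_informative (P x)); split; auto; discriminate. }
      destruct (HW p) as [z [[Hz Hzmin] Hu]]; [exists a; now apply Hp|].
      exists z; split; [split; [now apply Hp|intros b Hb; now apply Hzmin, Hp]|].
      intros a' Ha' Hm; apply Hu; split; [now apply Hp|].
      intros b Hb; now apply Hm, Hp. }
    exists (fun a b => W b a = false); split.
    - intros P HP; destruct (Hmin P HP) as [a [[Ha Hm] _]].
      exists a; split; [exact Ha|]; intros b Hb; rewrite Hm; auto; discriminate.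
    - intros a b; destruct (W b a) eqn:Hba; [|auto]; destruct (W a b) eqn:Hab; [|auto].
      right; left.
      assert (Hrefl : forall x, W x x = true).
      { intros x; destruct (Hmin (fun y => y = x)) as [z [[-> Hz] _]]; eauto. }
      (* Both [a] and [b] are least in the pair, so uniqueness of the least element identifies
         them. *)
      destruct (Hmin (fun y => y = a \/ y = b)) as [z [_ Hz]]; [eauto|].
      rewrite <- (Hz a), <- (Hz b); auto; intros y [->| ->]; auto. }
  destruct Hwo as [R [Hmin Htri]].
  assert (Hwf : forall (S : bset -> bset -> Prop),
            (forall P : bset -> Prop, (exists a, P a) ->
               exists a, P a /\ forall b, P b -> ~ S b a) -> well_founded S).
  { intros S HS a; apply NNPP; intros Ha.
    destruct (HS (fun x => ~ Acc S x)) as [m [Hm Hmm]]; [eauto|].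
    apply Hm; constructor; intros y Hy; apply NNPP; intros Hn; exact (Hmm y Hn Hy). }
  destruct (classic (forall a, countable_type {b | R b a})) as [Hc|Hc].
  { exists R; auto. }
  (* The least uncountable initial segment is in bijection with [bset] by CH. *)
  apply not_all_ex_not in Hc.
  destruct (Hmin _ Hc) as [a [Ha Hleast]]; clear Hc.
  destruct (HCH (fun b => R b a)) as [Hc|[g [Hinj Hsurj]]]; [contradiction|].
  pose (h z := proj1_sig (constructive_indefinite_description _ (Hsurj z))).
  assert (Hgh : forall z, g (h z) = z).
  { intros z; exact (proj2_sig (constructive_indefinite_description _ (Hsurj z))). }
  clearbody h; clear Hinj Hsurj.
  (* The segment order pulled back along [h]; the segment of [x] injects into the one below [h x],
     countable by the choice of [a]. *)
  exists (fun x y => R (proj1_sig (h x)) (proj1_sig (h y))); split; [|split].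
  - apply Hwf; intros P [x Hx].
    destruct (Hmin (fun b => exists y, P y /\ proj1_sig (h y) = b)) as [b [[y [Hy <-]] Hm]]; [eauto|].
    exists y; split; [exact Hy|]; intros z Hz; apply Hm; eauto.
  - intros x y; destruct (Htri (proj1_sig (h x)) (proj1_sig (h y))) as [H|[H|H]]; auto.
    right; left; rewrite <- (Hgh x), <- (Hgh y); f_equal.
    destruct (h x) as [u Hu], (h y) as [v Hv]; simpl in H; subst v; f_equal; apply proof_irrelevance.
  - intros x.
    assert (Hx : countable_type {b | R b (proj1_sig (h x))}).
    { apply NNPP; intros Hn; exact (Hleast _ Hn (proj2_sig (h x))). }
    destruct Hx as [f Hf].
    exists (fun y : {y | R (proj1_sig (h y)) (proj1_sig (h x))} =>
      f (exist _ (proj1_sig (h (proj1_sig y))) (proj2_sig y))).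
    intros [y Hy] [z Hz] H; apply Hf in H; simpl in H; injection H as H.
    assert (y = z) as ->.
    { rewrite <- (Hgh y), <- (Hgh z); f_equal.
      destruct (h y) as [u Hu], (h z) as [v Hv]; simpl in H; subst v; f_equal; apply proof_irrelevance. }
    f_equal; apply proof_irrelevance.
Qed.

(** [Fix] hands over a function on predecessors and proofs; collecting its values into a set lets
    the equation mention [b] alone. *)
Lemma transfinite_recursion (T U : Type) (R : T -> T -> Prop) (step : T -> (U -> Prop) -> U) :
  well_founded R -> exists b : T -> U, forall a, b a = step a (fun u => exists y, R y a /\ u = b y).
Proof.
  intros Hwf.
  pose (G a (rec : forall y, R y a -> U) := step a (fun u => exists y (h : R y a), u = rec y h)).
  exists (Fix Hwf (fun _ => U) G); intros a.
  rewrite Fix_eq.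
  - unfold G at 1; f_equal; apply functional_extensionality; intros u.
    apply boolp.propext; split; intros [y [H1 H2]]; eauto.
  - intros x f g H; f_equal; apply functional_extensionality_dep; intros y.
    apply functional_extensionality_dep; auto.
Qed.

Lemma countable_enum (F0 : bset -> Prop) (f0 : nat -> bset) (T : Type) (b : T -> bset) :
  (forall A, F0 A -> exists n, f0 n = A) -> countable_type T ->
  exists f : nat -> bset, forall A, F0 A \/ (exists t, A = b t) -> exists n, f n = A.
Proof.
  intros Hf0 [g Hg].
  (* Even indices follow [f0], odd indices invert the injection [g]; [empty] is a dummy for indices
     outside its range. *)
  exists (fun n => if Nat.even n then f0 (Nat.div2 n) else
     match excluded_middle_informative (exists t, g t = Nat.div2 n) with
     | left H => b (proj1_sig (constructive_indefinite_description _ H))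
     | right _ => empty
     end).
  intros A [HA|[t ->]].
  - destruct (Hf0 A HA) as [n <-]; exists (2 * n).
    now rewrite Nat.even_even, Nat.div2_double.
  - exists (2 * g t + 1); rewrite Nat.even_odd, Nat.add_1_r, Nat.div2_succ_double.
    destruct (excluded_middle_informative _) as [H|H]; [|exfalso; eauto].
    destruct (constructive_indefinite_description _ H) as [s Hs]; simpl.
    now rewrite (Hg s t Hs).
Qed.

(** One set [z] codes a pair through its even and odd positions, so the well-order of [bset] gives
    every pair its turn, at a countable stage. *)
Lemma CH_settling_family (F0 : bset -> Prop) (f0 : nat -> bset) :
  CH -> (forall A, F0 A -> exists n, f0 n = A) -> (exists A, F0 A) -> good F0 ->
  exists F, good F /\ (forall A, F0 A -> F A) /\ forall I X, incl I X -> settles F I X.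
Proof.
  intros HCH Hf0 [A0 HA0] HF0.
  destruct (CH_well_order HCH) as [R [Hwf [Htri Hcount]]].
  pose (evens (z : bset) := fun n => z (2 * n)).
  pose (odds (z : bset) := fun n => z (2 * n + 1)).
  pose (spec z F B := good (add F B) /\
          (incl (evens z) (odds z) -> settles (add F B) (evens z) (odds z))).
  (* Choice picks a set meeting [spec]; that one exists is shown afterwards by induction along
     [R]. *)
  destruct (transfinite_recursion bset bset R
     (fun z P => epsilon (inhabits empty) (spec z (fun A => F0 A \/ P A))) Hwf) as [b Hb].
  pose (stage z A := F0 A \/ exists y, R y z /\ A = b y).
  assert (Hspec : forall z, spec z (stage z) (b z)).
  { intros z; induction z as [z IH] using (well_founded_ind Hwf).
    rewrite Hb; apply epsilon_spec.
    assert (Hgood : good (stage z)).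
    { assert (Hin : forall A x, F0 A -> R x z -> compatible A (b x)).
      { intros A x HA Hx; apply (proj1 (IH x Hx)); [left; now left|now right]. }
      intros A B [HA|[x [Hx ->]]] [HB|[y [Hy ->]]]; auto using compatible_sym.
      (* Of two added sets, the later one was chosen compatible with a stage that contains the
         earlier one. *)
      destruct (Htri x y) as [H|[H|H]].
      - apply (proj1 (IH y Hy)); [left; right; eauto|now right].
      - subst; apply compatible_refl.
      - apply (proj1 (IH x Hx)); [now right|left; right; eauto]. }
    destruct (countable_enum F0 f0 _ (fun y : {y | R y z} => b (proj1_sig y)) Hf0 (Hcount z))
      as [f Hf].
    destruct (classic (incl (evens z) (odds z))) as [Hi|Hi].
    - destruct (extend_good (stage z) f (evens z) (odds z)) as [B [HB1 HB2]]; auto.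
      + intros A [HA|[y [Hy ->]]]; apply Hf; [now left|].
        right; now exists (exist _ y Hy).
      + exists A0; now left.
      + exists B; split; auto.
    (* A code without inclusion demands no settling, so an old member is repeated. *)
    - exists A0; split; [|contradiction].
      intros A B [HA|HA] [HB|HB]; apply Hgood; subst; auto; now left. }
  exists (fun A => F0 A \/ exists y, A = b y); split; [|split].
  - assert (Hin : forall A x, F0 A -> compatible A (b x)).
    { intros A x HA; apply (proj1 (Hspec x)); [left; now left|now right]. }
    intros A B [HA|[x ->]] [HB|[y ->]]; auto using compatible_sym.
    destruct (Htri x y) as [H|[H|H]].
    + apply (proj1 (Hspec y)); [left; right; eauto|now right].
    + subst; apply compatible_refl.
    + apply (proj1 (Hspec x)); [now right|left; right; eauto].
  - auto.
  - intros I X HIX.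
    pose (z n := if Nat.even n then I (Nat.div2 n) else X (Nat.div2 n)).
    assert (Hlo : evens z = I).
    { apply functional_extensionality; intros n; unfold evens, z.
      now rewrite Nat.even_even, Nat.div2_double. }
    assert (Hhi : odds z = X).
    { apply functional_extensionality; intros n; unfold odds, z.
      now rewrite Nat.even_odd, Nat.add_1_r, Nat.div2_succ_double. }
    destruct (Hspec z) as [_ Hs]; rewrite Hlo, Hhi in Hs.
    specialize (Hs HIX); revert Hs; apply settles_mono.
    intros A [[HA|[y [_ ->]]]| ->]; eauto.
Qed.

(** * Four initial bases from residues modulo 6 *)

Definition periodic (p : bset) : bset := fun n => p (n mod 6).

Definition some_residue (p : bset) : bool := existsb p (seq 0 6).

Lemma periodic_infinite p : some_residue p = true -> infinite (periodic p).
Proof.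
  intros H N; apply existsb_exists in H as [r [Hr Hp]]; apply in_seq in Hr.
  exists (r + N * 6); split; [lia|].
  unfold periodic; now rewrite Nat.Div0.mod_add, Nat.mod_small by lia.
Qed.

(** Each residue recurs infinitely often, so one witness per condition suffices; a residue on which
    [p] and [q] agree rules out complementarity. *)
Lemma periodic_compatible p q :
  some_residue (diff p q) = true -> some_residue (diff q p) = true ->
  some_residue (fun r => Bool.eqb (p r) (q r)) = true ->
  compatible (periodic p) (periodic q).
Proof.
  intros H1 H2 H3; split; [right; split|].
  - apply infinite_not_almost_incl; exact (periodic_infinite _ H1).
  - apply infinite_not_almost_incl; exact (periodic_infinite _ H2).
  - intros [N [HN _]]; destruct (periodic_infinite _ H3 N) as [n [Hn H]].
    specialize (HN n Hn); revert HN H; unfold periodic, compl.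
    destruct (p (n mod 6)), (q (n mod 6)); discriminate.
Qed.

Definition residues (s : list nat) : bset := fun r => existsb (Nat.eqb r) s.

(** The first two classes are disjoint, the last two cover [nat], and no two are complementary. *)
Definition seeds : list bset :=
  List.map (fun s => periodic (residues s))
    ((0 :: 1 :: nil) :: (2 :: 3 :: nil) :: (0 :: 2 :: 4 :: 5 :: nil) :: (1 :: 3 :: 4 :: 5 :: nil) :: nil)%list.

Lemma good_seeds : good (fun A => In A seeds).
Proof.
  intros A B HA HB; simpl in HA, HB.
  destruct HA as [<-|[<-|[<-|[<-|[]]]]], HB as [<-|[<-|[<-|[<-|[]]]]];
    (apply compatible_refl || (apply periodic_compatible; reflexivity)).
Qed.

(** * The uniform matroid with bases [closure F] *)

Section UniformMatroid.
Context (F : bset -> Prop) (HF : good F) (Hne : exists A, F A)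
  (Hsettle : forall I X, incl I X -> settles F I X).

Definition indep_of (P : nat -> Prop) : Prop :=
  exists B, closure F B /\ forall n, P n -> B n = true.

Definition set_of (A : bset) : nat -> Prop := fun n => A n = true.

Lemma set_of_surj (P : nat -> Prop) : exists A, P = set_of A.
Proof.
  exists (fun n => if excluded_middle_informative (P n) then true else false).
  apply functional_extensionality; intros n; apply boolp.propext; unfold set_of.
  destruct (excluded_middle_informative (P n)); split; auto; discriminate.
Qed.

Lemma closure_antichain A B : closure F A -> closure F B -> incl A B -> A = B.
Proof. intros HA HB; now apply compatible_incl_eq, (good_closure F HF). Qed.

Lemma closure_maximal_in B X :
  closure F B -> subset (set_of B) X -> maximal_in indep_of X (set_of B).
Proof.
  intros HB HX; split; [exists B; auto|split; [exact HX|]].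
  intros J [C [HC HJ]] _ HBJ.
  rewrite (closure_antichain B C); auto. intros n Hn; apply HJ, HBJ, Hn.
Qed.

Lemma is_base_closure P : is_base indep_of P <-> exists B, closure F B /\ P = set_of B.
Proof.
  split.
  - intros [[B [HB HP]] [_ Hmax]]; exists B; split; [exact HB|].
    apply functional_extensionality; intros n; apply boolp.propext; split; [apply HP|].
    apply (Hmax (set_of B)); [exists B; auto|now intros x _|exact HP].
  - intros [B [HB ->]]; apply closure_maximal_in; [exact HB|now intros x _].
Qed.

Lemma uniform_matroid : is_matroid indep_of.
Proof.
  split; [|split; [|split]].
  - destruct Hne as [A HA]; exists A; split; [exists A; split; auto using exchange_refl|tauto].
  - intros X Y [B [HB HY]] HXY; exists B; split; auto.
  - intros I B [B' [HB' HI]] HB HnI.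
    apply is_base_closure in HB as [B0 [HB0 ->]].
    assert (Hy : exists y, B' y = true /\ ~ I y).
    { apply NNPP; intros H; apply HnI, is_base_closure; exists B'; split; [exact HB'|].
      apply functional_extensionality; intros n; apply boolp.propext; split; [apply HI|].
      intros Hn; apply NNPP; intros HIn; apply H; eauto. }
    destruct Hy as [y [Hy HIy]].
    (* Otherwise [B0] lies in [I], hence in [B'], and the antichain property puts [y] into [I]. *)
    assert (Hx : exists x, B0 x = true /\ ~ I x).
    { apply NNPP; intros H.
      assert (HBI : forall n, B0 n = true -> I n).
      { intros n Hn; apply NNPP; intros HIn; apply H; eauto. }
      apply HIy, HBI; rewrite (closure_antichain B0 B'); auto.
      intros n Hn; apply HI, HBI, Hn. }
    destruct Hx as [x [Hx HIx]]; exists x; split; [exact Hx|split; [exact HIx|]].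
    destruct (B' x) eqn:HB'x.
    { exists B'; split; [exact HB'|]; intros n [Hn| ->]; auto. }
    (* As [y] is outside [I], exchanging it for [x] keeps [I] inside the base. *)
    exists (upd (upd B' y false) x true); split.
    + destruct HB' as [A [HA HBA]]; exists A; split; [exact HA|].
      apply (exchange_trans _ B'); [now apply exchange_swap|exact HBA].
    + intros n [Hn| ->]; unfold upd; [|now rewrite Nat.eqb_refl].
      destruct (Nat.eqb_spec n x); [reflexivity|].
      destruct (Nat.eqb_spec n y) as [->|]; [contradiction|auto].
  - intros Q P [B [HB HI]] HPQ.
    destruct (set_of_surj P) as [I ->]; destruct (set_of_surj Q) as [X ->].
    (* In the three cases [X] is independent, [I] is itself a base, or a base lies between them. *)
    assert (Hdone : (exists C, closure F C /\ (incl X C \/ incl C I \/ incl I C /\ incl C X)) ->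
              exists J, subset (set_of I) J /\ maximal_in indep_of (set_of X) J).
    { intros [C [HC [H|[H|[H1 H2]]]]].
      - exists (set_of X); split; [exact HPQ|]; split; [exists C; auto|]; now split.
      - assert (HCB : C = B) by (apply closure_antichain; auto; intros n Hn; apply HI, H, Hn).
        exists (set_of C); split; [intros n Hn; subst; now apply HI|].
        apply closure_maximal_in; [exact HC|]; intros n Hn; apply HPQ, H, Hn.
      - exists (set_of C); split; [exact H1|]; now apply closure_maximal_in. }
    destruct (Hsettle I X HPQ) as [HXI|H]; [|now apply Hdone].
    (* When [X] is almost in [I], it is almost in [B]. Interpolating between [X] and [full] gives a
       base above [X], or one inside [X]; in the latter case [B] is almost in [X] and can be
       interpolated between [I] and [X]. *)
    assert (Hex : forall C, exchange C B -> closure F C).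
    { intros C HC; destruct HB as [A [HA HBA]]; exists A; split; [exact HA|].
      now apply (exchange_trans _ B). }
    assert (HXB : almost_incl X B).
    { apply (almost_incl_trans _ I); [exact HXI|now apply incl_almost]. }
    destruct (exchange_interpolate X B full) as [C [HC [H|[H|[H _]]]]].
    + intros n _; reflexivity.
    + exact HXB.
    + exists 0; reflexivity.
    + apply Hdone; exists C; split; [auto|]. left; intros n _; now apply H.
    + destruct (exchange_interpolate I B X) as [D [HD HID]]; [exact HPQ|now apply incl_almost| |eauto].
      apply (almost_incl_trans _ C); [|now apply incl_almost].
      now apply exchange_almost_incl, exchange_sym.
    + apply Hdone; exists C; split; auto.
Qed.
End UniformMatroid.

(** * Packing and covering without partitioning *)

Theorem theorem1p5 :
  CH ->
  exists (E : Type) (indep : (E -> Prop) -> Prop),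
    countable_type E /\ is_matroid indep /\
    two_base_packing indep /\ two_base_covering indep /\
    ~ two_base_partitioning indep.
Proof.
  intros HCH.
  destruct (CH_settling_family (fun A => In A seeds) (fun n => nth n seeds empty) HCH)
    as [F [HF [Hseeds Hsettle]]].
  { intros A HA; destruct (In_nth seeds A empty HA) as [n [_ Hn]]; eauto. }
  { eexists; now left. }
  { exact good_seeds. }
  assert (Hbase : forall s, In (periodic (residues s)) seeds ->
            is_base (indep_of F) (set_of (periodic (residues s)))).
  { intros s Hs; apply is_base_closure; [exact HF|].
    eexists; split; [|reflexivity]. eexists; split; [exact (Hseeds _ Hs)|apply exchange_refl]. }
  assert (Hres : forall n, n mod 6 < 6) by (intros n; apply Nat.mod_upper_bound; discriminate).
  exists nat, (indep_of F); split; [|split; [|split; [|split]]].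
  - exists (fun n => n); auto.
  - apply uniform_matroid; auto. eexists; apply Hseeds, or_introl; reflexivity.
  - exists (set_of (periodic (residues (0 :: 1 :: nil)))), (set_of (periodic (residues (2 :: 3 :: nil)))).
    split; [apply Hbase; simpl; auto|split; [apply Hbase; simpl; auto|]].
    intros n; unfold set_of, periodic; generalize (n mod 6), (Hres n); intros r Hr.
    do 6 (destruct r as [|r]; [compute; intuition discriminate|]); lia.
  - exists (set_of (periodic (residues (0 :: 2 :: 4 :: 5 :: nil)))),
      (set_of (periodic (residues (1 :: 3 :: 4 :: 5 :: nil)))).
    split; [apply Hbase; simpl; auto|split; [apply Hbase; simpl; auto|]].
    intros n; unfold set_of, periodic; generalize (n mod 6), (Hres n); intros r Hr.
    do 6 (destruct r as [|r]; [compute; auto|]); lia.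
  - intros [B1 [B2 [H1 [H2 [Hdisj Hcov]]]]].
    apply is_base_closure in H1 as [A1 [HA1 ->]]; [|exact HF].
    apply is_base_closure in H2 as [A2 [HA2 ->]]; [|exact HF].
    (* A partitioning makes [A1] the complement of [A2], against the second part of
       compatibility. *)
    destruct (good_closure F HF A1 A2 HA1 HA2) as [_ Hc]; apply Hc.
    assert (A1 = compl A2) as ->; [|apply exchange_refl].
    apply functional_extensionality; intros n.
    specialize (Hdisj n); specialize (Hcov n); unfold set_of, compl in *.
    destruct (A1 n), (A2 n); tauto || (destruct Hcov; discriminate).
Qed.
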